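(* Fix $\alpha \in (0,1)$, and let $K_\alpha$ be the size of the first block in a $\mathbf{p}$-biased permutation, where $\mathbf{p}$ is the probability distribution on the positive integers of a random variable $X_1$ with $\mathbf{P}[X_1 \geq k] = C_\alpha e^{-k^\alpha}$ for all integers $k \ge 1$, with $C_\alpha$ a normalizing constant. Then $$\mathbf{P}[K_\alpha = \infty] > 0.$$
   Context: Let $\mathbf{p} = (p_1, p_2, \dots)$ be a probability distribution on the positive integers with each $p_j > 0$, and let $X_1, X_2, \dots$ be i.i.d. with distribution $\mathbf{p}$. The $\mathbf{p}$-biased permutation is the map $i \mapsto \Pi_i$, where $(\Pi_1, \Pi_2, \dots)$ is the sequence of distinct values of $(X_1, X_2, \dots)$ in order of appearance (almost surely every positive integer appears). Write $[k] = \{1,\dots,k\}$. The first block is the smallest interval $[K]$ with $\Pi([K]) = [K]$, and the size of the first block is $K = \inf\{k \ge 1 : \Pi([k]) = [k]\}$, with $\inf\emptyset = \infty$. The normalizing constant $C_\alpha$ is chosen so that $\mathbf{P}[X_1 \ge 1] = 1$. *)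

(* Defs.v *)
From HB Require Import structures.
From mathcomp Require Import all_boot all_order all_algebra.
From mathcomp Require Import all_classical all_reals all_analysis.
Set Implicit Arguments.
Unset Strict Implicit.
Unset Printing Implicit Defensive.
Import Order.TTheory GRing.Theory Num.Theory.
Local Open Scope classical_set_scope.
Local Open Scope ring_scope.

Section iid.
Context d d' (Omega : measurableType d) (T : measurableType d') (R : realType).
Variable P : probability Omega R.

Definition mutually_independent (X : nat -> {RV P >-> T}) : Prop :=
  forall (J : seq nat) (B : nat -> set T),
    uniq J -> (forall i, measurable (B i)) ->
    P (\bigcap_(i in [set` J]) (X i @^-1` B i)) =
    (\prod_(i <- J) P (X i @^-1` B i))%E.

Definition identically_distributed (X : nat -> {RV P >-> T}) : Prop :=
  forall n (B : set T), measurable B ->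
    distribution P (X n) B = distribution P (X 0%N) B.

Definition iid (X : nat -> {RV P >-> T}) : Prop :=
  mutually_independent X /\ identically_distributed X.

End iid.

(* The times of a sequence [x : nat -> nat] are counted from 0 (so [x n] stands
   for the sample X_(n+1)); the positions [i] of the permutation and the sizes
   [k] of intervals are counted from 1. *)
Definition past (x : nat -> nat) (n : nat) : seq nat := map x (iota 0 n).

(* The i-th distinct value of x shows up for the first time at time n. *)
Definition appears_at (x : nat -> nat) (i n : nat) : bool :=
  (x n \notin past x n) && ((size (undup (past x n))).+1 == i).

(* At most one time n satisfies [appears_at x i n]. The value is the junk 0,
   which is not a positive integer, if i = 0 or if x takes fewer than i
   distinct values. *)
Definition biased_perm (x : nat -> nat) (i : nat) : nat :=
  xget 0%N [set x n | n in [set n | appears_at x i n]].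

Definition initial_interval (k : nat) : set nat := [set i | (1 <= i <= k)%N].

Definition first_block_size (R : realType) (x : nat -> nat) : \bar R :=
  ereal_inf [set (k%:R)%:E | k in
    [set k | (1 <= k)%N /\
             biased_perm x @` initial_interval k = initial_interval k]].

(* Main.v *)
Require Import Defs.
From HB Require Import structures.
From mathcomp Require Import all_boot all_order all_algebra.
From mathcomp Require Import all_classical all_reals all_analysis.
From mathcomp Require Import ring lra zify.
Set Implicit Arguments.
Unset Strict Implicit.
Unset Printing Implicit Defensive.
Import Order.TTheory GRing.Theory Num.Theory.
Local Open Scope classical_set_scope.
Local Open Scope ring_scope.

(** Why the first block may be infinite. The interval [k] is a union of blocks
exactly when every value of [k] is sampled before any value outside [k]: at some
time n the set of values seen so far is [k] ([fills_at], [block_fills]). For the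
tail q_k = P(X >= k) = C exp(-k^alpha) with alpha < 1, the mass p_j of a single value j near k is smaller than the tail beyond k by a factor of order
k^(alpha-1), because j^alpha grows by at most j^(alpha-1) in one step
([weibull_mass_le]). Hence it is very hard to collect all the values just below
k before anything larger than k turns up.

Quantitatively, let eps = (1 - alpha) / 2, fix an integer r with r * eps >= 2,
and look at the first N samples, where N is about k^eps / q_(k+1). If [k] is
filled, then either all the samples up to time N are at most k, with
probability at most (1 - q_(k+1))^N <= exp(-k^eps) <= r! / k^(r eps), or the r
values just below k all appear in the first N + 1 samples
([fills_dichotomy]). A union bound over the times at which they appear bounds
the latter by the product of the (N + 1) p_j
([prob_cylinder_hit_le]), and each factor is at most a constant times k^(-eps).
Both terms are O(1 / k^2) ([first_block_tail_bound]), which is summable.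

A convergent sum does not by itself exclude the small intervals. They are
excluded by conditioning on the first sample X_1 = m: no interval [k] with
k < m can then be filled, and if m is large the probabilities for k >= m add
up to some s < 1. Conditioning costs only the value m, which is left out of the
r values to be collected. Since the event X_1 = m has positive probability, so
has K = oo: P(K = oo) >= P(X_1 = m) (1 - s) ([never_fills_gt0]). *)

(** * Blocks as times at which an initial interval has been collected *)

Definition distinct_count (x : nat -> nat) (n : nat) : nat :=
  size (undup (past x n)).

Lemma mem_past x n v : reflect (exists2 i, (i < n)%N & x i = v) (v \in past x n).
Proof.
apply: (iffP mapP) => [[i]|[i lin <-]]; last first.
  by exists i => //; rewrite mem_iota.
by rewrite mem_iota => /= ? ->; exists i.
Qed.

Lemma pastS x n : past x n.+1 = rcons (past x n) (x n).
Proof. by rewrite /past -addn1 iotaD map_cat cats1. Qed.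

Lemma distinct_countS x n :
  distinct_count x n.+1 = (distinct_count x n + (x n \notin past x n))%N.
Proof.
rewrite /distinct_count pastS undup_rcons size_rcons -rem_filter ?undup_uniq//.
have [xn|xn] := boolP (x n \in past x n).
  rewrite size_rem ?mem_undup// addn0 prednK// lt0n size_eq0.
  by apply: contraTneq xn; rewrite -mem_undup => ->.
by rewrite rem_id ?mem_undup// addn1.
Qed.

Lemma leq_distinct_count x : {homo distinct_count x : m n / (m <= n)%N}.
Proof.
by apply: homo_leq leq_trans _ => // n; rewrite distinct_countS leq_addr.
Qed.

(** The number of distinct values is monotone and jumps just after the time at
which a new value appears, so it takes a given value before only one jump. *)
Lemma appears_at_uniq x i m n : appears_at x i m -> appears_at x i n -> m = n.
Proof.
suff lt_absurd p q : (p < q)%N -> appears_at x i p -> appears_at x i q -> False.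
  move=> im i_n; case: (ltngtP m n) => // mn; exfalso.
  - exact: lt_absurd mn im i_n.
  - exact: lt_absurd mn i_n im.
move=> pq /andP[xp /eqP ip] /andP[_ /eqP iq].
have := leq_distinct_count x pq.
rewrite distinct_countS xp addn1 /distinct_count -[X in (X <= _)%N -> _]/(size _).+1.
by move: iq; rewrite -ip => -[->]; rewrite ltnn.
Qed.

Lemma biased_perm_appears x i n : appears_at x i n -> biased_perm x i = x n.
Proof.
move=> i_n; apply: xget_subset1 => [|_ _ [p ip <-] [q iq <-]]; first by exists n.
by rewrite (appears_at_uniq ip iq).
Qed.

(** Turns statements about the permutation into statements about finite
prefixes of the sample. *)
Lemma image_biased_perm x n :
  biased_perm x @` initial_interval (distinct_count x n) = [set` past x n].
Proof.
elim: n => [|n IHn].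
  apply/seteqP; split=> v //= [i /andP[i0]].
  by rewrite leqNgt i0.
have -> : [set` past x n.+1] = [set` past x n] `|` [set x n].
  rewrite pastS; apply/seteqP; split=> v; rewrite /= mem_rcons in_cons.
      by case/predU1P=> [->|]; [right|left].
    by case=> [|->]; rewrite ?eqxx// => ->; rewrite orbT.
rewrite distinct_countS -IHn; have [xn|xn] := boolP (x n \in past x n).
  rewrite addn0; apply/esym/setUidPl => _ ->.
  by rewrite IHn.
have app : appears_at x (distinct_count x n).+1 n by rewrite /appears_at xn eqxx.
rewrite addn1; apply/seteqP; split => v.
  case=> i /= /andP[i0]; rewrite leq_eqVlt => /predU1P[-> <-|iD <-].
    by right; apply: biased_perm_appears.
  by left; exists i => //=; apply/andP.
case=> [[i /= /andP[i0 iD] <-]|->].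
  by exists i => //=; apply/andP; split=> //; apply: leqW.
exists (distinct_count x n).+1; last exact: biased_perm_appears.
exact/andP.
Qed.

Definition fills_at (x : nat -> nat) (k n : nat) : Prop :=
  [set` past x n] = initial_interval k.

Lemma initial_interval_iota k : initial_interval k = [set` iota 1 k].
Proof. by apply/seteqP; split=> i /=; rewrite mem_iota add1n ltnS. Qed.

(** Given that the permutation preserves [k], the time that works is the one just
after the k-th distinct value shows up. Conversely, a prefix whose set of values
is [k] has k distinct values, and these are the first k of the permutation. *)
Lemma block_fills x k : (1 <= k)%N ->
  (biased_perm x @` initial_interval k = initial_interval k) <->
  exists n, fills_at x k n.
Proof.
move=> k0; split=> [imk|[n fn]].
- have [n kn] : exists n, appears_at x k n.
    (* The default value 0 of [biased_perm] lies outside the interval. *)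
    have : initial_interval k (biased_perm x k).
      by rewrite -imk; exists k => //; apply/andP.
    by rewrite /biased_perm; case: xgetP => //= _ _ [n kn _] _; exists n.
  exists n.+1; move: kn => /andP[xn /eqP kn].
  by rewrite /fills_at -image_biased_perm distinct_countS xn addn1 /distinct_count kn.
- suff kn : k = distinct_count x n by rewrite {1}kn image_biased_perm.
  rewrite -[LHS](size_iota 1) /distinct_count; apply/perm_size/uniq_perm.
  + exact: iota_uniq.
  + exact: undup_uniq.
  + move=> v; rewrite mem_undup; apply/idP/idP.
      by have /seteqP[_] := fn; rewrite initial_interval_iota; exact.
    by have /seteqP[+ _] := fn; rewrite initial_interval_iota; exact.
Qed.

Lemma first_block_size_pinfty (R : realType) x :
  first_block_size R x = +oo%E <->
  forall k, (1 <= k)%N -> forall n, ~ fills_at x k n.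
Proof.
rewrite ereal_inf_pinfty; split=> [noblock k k1 n fn|nofill _ [k [k1 imk] <-]].
  suff : [set +oo%E] (k%:R%:E : \bar R) by [].
  by apply: noblock; exists k => //; split=> //; apply/block_fills => //; exists n.
by have [n /(nofill k k1 n)] := (block_fills x k1).1 imk.
Qed.

(** If [k] is filled at time n, the two cases are n > N and n <= N. *)
Lemma fills_dichotomy x k n N (js : seq nat) : {in js, forall j, (1 <= j <= k)%N} ->
  fills_at x k n ->
  (forall i, (i <= N)%N -> (x i <= k)%N) \/ {subset js <= past x N.+1}.
Proof.
move=> js_k fn; have [nN|Nn] := leqP n N.
  right=> j /js_k jk; have : [set` past x n] j by rewrite fn.
  case/mem_past => i i_n <-; apply/mem_past; exists i => //.
  by rewrite ltnS (leq_trans (ltnW i_n)).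
left=> i iN; have : [set` past x n] (x i).
  by apply/mem_past; exists i => //; exact: leq_ltn_trans Nn.
by rewrite fn => /andP[].
Qed.

(** * Independence and the union bound *)

Section events.
Context d (Omega : measurableType d) (R : realType) (P : probability Omega R).
Variable X : nat -> {RV P >-> nat}.

Let path w : nat -> nat := fun n => X n w.

(** Every property of a prefix is measurable because a prefix takes countably
many values; the induction conditions on the last sample. *)
Lemma measurable_past (Q : set (seq nat)) n :
  measurable [set w | Q (past (path w) n)].
Proof.
elim: n Q => [|n IHn] Q.
  have [q|nq] := pselect (Q [::]).
    by rewrite (_ : mkset _ = setT)//; apply/seteqP; split.
  by rewrite (_ : mkset _ = set0)//; apply/seteqP; split.
have -> : [set w | Q (past (path w) n.+1)] =
    \bigcup_v (X n @^-1` [set v] `&` [set w | Q (rcons (past (path w) n) v)]).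
  apply/seteqP; split=> w.
    by rewrite /mkset pastS => Qw; exists (X n w).
  by case=> v _ [/= <-]; rewrite -/(path w n) -pastS.
apply: bigcupT_measurable => v; apply: measurableI; last first.
  exact: (IHn [set s | Q (rcons s v)]).
exact: measurable_funPTI.
Qed.

Lemma measurable_hit (js : seq nat) N :
  measurable [set w | {subset js <= past (path w) N}].
Proof. exact: (measurable_past [set s : seq nat | {subset js <= s}]). Qed.

Definition cylinder (J : seq nat) (B : nat -> set nat) : set Omega :=
  \bigcap_(i in [set` J]) (X i @^-1` B i).

Lemma measurable_cylinder J B : measurable (cylinder J B).
Proof. by apply: bigcap_measurableType => i _; exact: measurable_funPTI. Qed.

Hypothesis X_iid : iid X.

Lemma prob_same_law n B : P (X n @^-1` B) = P (X 0%N @^-1` B).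
Proof. exact: (X_iid.2 n B I). Qed.

Lemma prob_cylinder J B : uniq J ->
  P (cylinder J B) = (\prod_(i <- J) P (X i @^-1` B i))%E.
Proof. by move=> uJ; apply: X_iid.1. Qed.

(** Union bound over the times i < N at which the values of [js] appear. The
independent constraints [B] on the times in [J] are carried along so that each
step of the induction on [js] can move one value to a new constraint X_i = j.
The times already in [J] contribute nothing, because their constraints exclude
the values still to be hit; the times in use therefore stay distinct. *)
Lemma prob_cylinder_hit_le N (js J : seq nat) (B : nat -> set nat) :
  uniq js -> uniq J -> (forall i j, i \in J -> j \in js -> ~ B i j) ->
  (P (cylinder J B `&` [set w | {subset js <= past (path w) N}]) <=
   (\prod_(i <- J) P (X i @^-1` B i)) *
   \prod_(j <- js) (N%:R%:E * P (X 0%N @^-1` [set j])))%E.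
Proof.
elim: js J B => [|j js IHjs] J B.
  move=> _ uJ _; rewrite big_nil mule1 -prob_cylinder//.
  apply: le_measure; rewrite ?inE; last exact: subIsetl.
  - by apply: measurableI; [exact: measurable_cylinder|exact: measurable_hit].
  - exact: measurable_cylinder.
rewrite cons_uniq => /andP[jjs ujs] uJ avoid.
pose upd i : nat -> set nat := fun i' => if i' == i then [set j] else B i'.
pose F i := if i \in J then set0 else
  cylinder (i :: J) (upd i) `&` [set w | {subset js <= past (path w) N}].
have mF i : measurable (F i).
  rewrite /F; case: ifP => // _.
  by apply: measurableI; [exact: measurable_cylinder|exact: measurable_hit].
have cover : cylinder J B `&` [set w | {subset j :: js <= past (path w) N}] `<=`
    \big[setU/set0]_(i < N) F i.
  move=> w [Jw hit].
  have /mem_past[i iN ij] : j \in past (path w) N by apply: hit; rewrite mem_head.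
  rewrite -bigcup_mkord; exists i => //; rewrite /F; case: ifP => iJ.
    by apply: (avoid i j iJ (mem_head _ _)); rewrite -ij; exact: Jw.
  split=> [i'|j' j'js]; last by apply: hit; rewrite in_cons j'js orbT.
  rewrite /= in_cons /upd; case: eqP => [-> _ //|_ /= i'J]; exact: Jw.
have mcover := measurableI _ _ (measurable_cylinder J B) (measurable_hit (j :: js) N).
apply: le_trans (content_subadditive P (fun i _ => mF i) mcover cover) _.
set b := (X in (_ <= X)%E).
have le1 (i : 'I_N) : true -> (P (F i) <= P (X 0%N @^-1` [set j]) *
   ((\prod_(i <- J) P (X i @^-1` B i)) *
   \prod_(j <- js) (N%:R%:E * P (X 0%N @^-1` [set j]))))%E.
  move=> _; rewrite /F; case: ifP => iJ.
    rewrite measure0 !mule_ge0// prode_ge0// => ?; rewrite mule_ge0// lee_fin//.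
  apply: le_trans (IHjs _ _ _ _ _) _ => //.
  - by rewrite /= iJ.
  - move=> i' j'; rewrite in_cons /upd; case: eqP => [_ _ j'js /= jj'|_ /= i'J j'js].
      by rewrite -jj' j'js in jjs.
    by apply: avoid => //; rewrite in_cons j'js orbT.
  rewrite big_cons -muleA {1}/upd eqxx prob_same_law.
  rewrite le_eqVlt; apply/orP; left; apply/eqP; congr (_ * (_ * _))%E.
  apply: eq_big_seq => i' i'J; rewrite /upd; case: eqP => // ii'.
  by rewrite -ii' i'J in iJ.
apply: le_trans (lee_sum _ le1) _.
rewrite /b big_cons sumr_const card_ord; set c := (X in (X *+ N)%R).
have -> : (c *+ N)%R = (N%:R%:E * c)%E by exact/esym/mule_natl.
by rewrite /c [leRHS]muleCA !muleA.
Qed.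

Definition law (B : set nat) : R := fine (P (X 0%N @^-1` B)).

Lemma lawE n B : P (X n @^-1` B) = (law B)%:E.
Proof.
by rewrite prob_same_law /law fineK// fin_num_measure//; exact: measurable_funPTI.
Qed.

Lemma law_ge0 B : 0 <= law B.
Proof. exact: fine_ge0. Qed.

Lemma measurable_fills k n : measurable [set w | fills_at (path w) k n].
Proof. exact: (measurable_past [set s : seq nat | [set` s] = initial_interval k]). Qed.

(** The two terms are the two cases of [fills_dichotomy]. The value [m] must stay
out of [js], as time 0 collects it for free. *)
Lemma prob_start_fills_le m k N (js : seq nat) :
  uniq js -> m \notin js -> {in js, forall j, (1 <= j <= k)%N} ->
  (P (X 0%N @^-1` [set m] `&` \bigcup_n [set w | fills_at (path w) k n]) <=
  (law [set m] * (law [set v | (v <= k)%N] ^+ N +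
                  \prod_(j <- js) (N.+1%:R * law [set j])))%:E)%E.
Proof.
move=> ujs mjs js_k.
pose B i : set nat := if i is 0%N then [set m] else [set v | (v <= k)%N].
pose A1 := cylinder (iota 0 N.+1) B.
pose A2 := cylinder [:: 0%N] B `&` [set w | {subset js <= past (path w) N.+1}].
have mA1 : measurable A1 by exact: measurable_cylinder.
have mA2 : measurable A2.
  by apply: measurableI; [exact: measurable_cylinder|exact: measurable_hit].
have PA1 : P A1 = (law [set m] * law [set v | (v <= k)%N] ^+ N)%:E.
  rewrite prob_cylinder ?iota_uniq// /= big_cons lawE EFinM; congr (_ * _)%E.
  rewrite (eq_big_seq (fun=> (law [set v | (v <= k)%N])%:E)).
    by rewrite prodEFin big_const_seq count_predT size_iota iter_mulr_1.
  by case=> [|i]; rewrite ?lawE// mem_iota.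
have PA2 : (P A2 <= (law [set m] * \prod_(j <- js) (N.+1%:R * law [set j]))%:E)%E.
  apply: le_trans (prob_cylinder_hit_le _ _ _ _) _ => //.
    by move=> i j; rewrite inE => /eqP -> /= jjs mj; rewrite -mj jjs in mjs.
  rewrite big_seq1 lawE EFinM -prodEFin.
  under eq_bigr do rewrite lawE -EFinM.
  by [].
rewrite mulrDr EFinD -PA1.
apply: le_trans (leeD (lexx _) PA2); apply: le_trans (measureU2 P mA1 mA2).
apply: le_measure; rewrite ?inE.
- apply: measurableI; first exact: measurable_funPTI.
  by apply: bigcupT_measurable => n; exact: measurable_fills.
- exact: measurableU.
- move=> w [/= X0m [n _ fn]].
  have [small|hit] := fills_dichotomy N js_k fn.
    left=> -[_ //|i iN]; apply: small.
    by have := iN; rewrite /mkset mem_iota => /andP[].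
  by right; split=> // i /=; rewrite inE => /eqP ->.
Qed.

(** On X_1 = m an interval [k] with k < m is never filled, since its complement
contains the first sample; so only the intervals [m + i] matter, and
they rule out at most a fraction s of the event X_1 = m. *)
Lemma never_fills_gt0 m s : 0 <= s < 1 -> 0 < law [set m] ->
  (forall n, (\sum_(0 <= i < n) P (X 0%N @^-1` [set m] `&`
     \bigcup_l [set w | fills_at (path w) (m + i) l]) <= (law [set m] * s)%:E)%E) ->
  (0 < P [set w | forall k, (1 <= k)%N -> forall n, ~ fills_at (path w) k n])%E.
Proof.
move=> /andP[s0 s1] pm0 sum_le.
set U := [set w | _].
pose F i := X 0%N @^-1` [set m] `&` \bigcup_l [set w | fills_at (path w) (m + i) l].
have mF i : measurable (F i).
  apply: measurableI; first exact: measurable_funPTI.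
  by apply: bigcupT_measurable => n; exact: measurable_fills.
have mU : measurable U.
  rewrite (_ : U = \bigcap_(k in [set k | (1 <= k)%N]) \bigcap_n
                     ~` [set w | fills_at (path w) k n]); last first.
    by apply/seteqP; split=> w Uw k k1 n => [_|]; exact: Uw.
  apply: bigcap_measurableType => k _; apply: bigcap_measurableType => n _.
  by apply: measurableC; exact: measurable_fills.
have mFU : measurable (\bigcup_i F i) by exact: bigcupT_measurable.
have PF : (P (\bigcup_i F i) <= (law [set m] * s)%:E)%E.
  apply: le_trans (generalized_Boole_inequality P mF mFU) _.
  apply: lime_le; first exact: is_cvg_nneseries.
  by near=> n; exact: sum_le.
have cover : X 0%N @^-1` [set m] `<=` U `|` \bigcup_i F i.
  move=> w X0m; have [Uw|nUw] := pselect (U w); [by left|right].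
  move/existsNP : nUw => [k /not_implyP[k1 /existsNP[n /contrapT fn]]].
  have mk : (m <= k)%N.
    have [n0|n0] := posnP n.
      have : [set` past (path w) n] k by rewrite fn; apply/andP.
      by rewrite n0.
    have : [set` past (path w) n] m by apply/mem_past; exists 0%N.
    by rewrite fn => /andP[].
  by exists (k - m)%N => //; split=> //; exists n => //; rewrite subnKC.
have : (P (X 0%N @^-1` [set m]) <= P U + P (\bigcup_i F i))%E.
  apply: le_trans (measureU2 P mU mFU); apply: le_measure; rewrite ?inE//.
  - exact: measurable_funPTI.
  - exact: measurableU.
rewrite lawE ltNge => le1; apply/negP => U0.
have : ((law [set m])%:E <= (law [set m] * s)%:E)%E.
  by apply: le_trans le1 _; rewrite -[leRHS]add0e; apply: leeD.
by rewrite lee_fin ler_pMr// leNgt s1.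
Unshelve. all: by end_near.
Qed.

End events.

(** * Stretched exponential tails *)

Section analysis.
Variable R : realType.
Implicit Types alpha : R.

(** From Bernoulli's inequality (1 + 1/j)^alpha <= 1 + 1/j. *)
Lemma powR_succ_le alpha j : 0 < alpha <= 1 -> (0 < j)%N ->
  j.+1%:R `^ alpha <= j%:R `^ alpha + j%:R `^ alpha / j%:R.
Proof.
move=> /andP[a0 a1] j0; have j_gt0 : 0 < j%:R :> R by rewrite ltr0n.
have -> : j.+1%:R = j%:R * (1 + j%:R^-1) :> R.
  by rewrite mulrDr mulr1 divff ?gt_eqF// -natr1.
rewrite powRM ?ler0n ?addr_ge0 ?invr_ge0 ?ler0n//.
rewrite -[X in _ <= X + _]mulr1 -mulrDr ler_wpM2l ?powR_ge0// ler1_powR//.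
by rewrite lerDl invr_ge0 ler0n.
Qed.

Lemma powR_addn_le alpha j i : 0 < alpha <= 1 -> (0 < j)%N ->
  (j + i)%:R `^ alpha <= j%:R `^ alpha + i%:R.
Proof.
move=> a01 j0; elim: i => [|i IHi]; first by rewrite addn0 addr0.
have ji0 : (0 < j + i)%N by rewrite addn_gt0 j0.
rewrite addnS (le_trans (powR_succ_le a01 ji0))// -natr1 addrA lerD//.
rewrite ler_pdivrMr ?ltr0n// mul1r ler1_powR ?ler1n//.
by case/andP: a01.
Qed.

(** The normalization makes the tail equal to 1 at k = 1, that is C = e. *)
Definition weibull_tail alpha (k : nat) : R := expR (1 - k%:R `^ alpha).

Lemma weibull_tail_le1 alpha k : 0 < alpha -> (0 < k)%N -> weibull_tail alpha k <= 1.
Proof.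
move=> a0 k0; rewrite -expR0 ler_expR subr_le0.
by rewrite -[leLHS](powRr0 k%:R) ler_powR ?ler1n// ltW.
Qed.

(** With h = j^alpha / j, passing from j to j + 1 multiplies the tail by at least
exp(-h) >= 1 - h, so the mass of j is at most h times the tail at j. Between
j and k + 1 the tail loses at most a constant factor, as the exponent grows by
at most 1 at each step. *)
Lemma weibull_mass_le alpha r j k : 0 < alpha <= 1 -> (0 < j)%N ->
  (k <= j + r)%N ->
  weibull_tail alpha j - weibull_tail alpha j.+1 <=
  expR r.+1%:R * weibull_tail alpha k.+1 * (j%:R `^ alpha / j%:R).
Proof.
move=> a01 j0 kjr; set h := _ / _.
have h0 : 0 <= h by rewrite divr_ge0 ?powR_ge0 ?ler0n.
apply: (@le_trans _ _ (weibull_tail alpha j * h)).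
  have : weibull_tail alpha j * (1 - h) <= weibull_tail alpha j.+1.
    apply: (@le_trans _ _ (weibull_tail alpha j * expR (- h))).
      by rewrite ler_wpM2l ?expR_ge0// expR_ge1Dx.
    rewrite /weibull_tail -expRD ler_expR -addrA lerD2l -opprD lerN2.
    exact: powR_succ_le.
  by rewrite mulrBr mulr1; lra.
rewrite ler_wpM2r// /weibull_tail -expRD ler_expR.
have : k.+1%:R `^ alpha <= j%:R `^ alpha + r.+1%:R.
  apply: le_trans (powR_addn_le r.+1 a01 j0).
  rewrite ge0_ler_powR ?nnegrE ?ler0n//; first by case/andP: a01 => /ltW.
  by rewrite ler_nat addnS.
lra.
Qed.

Lemma near_top_ge_half r j k : (0 < k)%N -> (2 * r <= k)%N -> (k - r <= j)%N ->
  [/\ (0 < j)%N, (k <= j + r)%N & (k <= 2 * j)%N].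
Proof. by move=> k0 rk kj; split; lia. Qed.

(** Writing y = k^eps and q for the tail at k + 1, one has y^2 = k / k^alpha and
y^r >= k^2, and N is taken close to y / q. Then N q >= y makes the first term
at most exp(-y), and each (N + 1) p_j is at most
3 (y / q) * e^(r+1) q * 2 / y^2 = D / y, where the 2 comes from k <= 2 j. *)
Lemma first_block_tail_bound alpha : 0 < alpha < 1 ->
  exists r : nat, exists2 c : R, 0 <= c & forall k, (0 < k)%N -> (2 * r <= k)%N ->
    exists N : nat, forall js : seq nat, size js = r ->
      {in js, forall j, (k - r <= j <= k)%N} ->
      (1 - weibull_tail alpha k.+1) ^+ N +
      \prod_(j <- js) (N.+1%:R * (weibull_tail alpha j - weibull_tail alpha j.+1))
      <= c / k%:R ^+ 2.
Proof.
move=> /andP[a0 a1].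
have a01 : 0 < alpha <= 1 by rewrite a0 ltW.
pose eps := (1 - alpha) / 2.
have eps0 : 0 < eps by rewrite divr_gt0// subr_gt0.
pose r := (Num.trunc (2 / eps)).+1.
have r_eps : 2 <= eps * r%:R.
  by rewrite mulrC -ler_pdivrMr// ltW// truncnS_gt.
pose D := 6 * expR r.+1%:R : R.
have D0 : 0 <= D by rewrite mulr_ge0 ?expR_ge0.
exists r, (r`!%:R + D ^+ r); first by rewrite addr_ge0 ?exprn_ge0.
move=> k k0 rk; have k_gt0 : 0 < k%:R :> R by rewrite ltr0n.
have k_ge1 : 1 <= k%:R :> R by rewrite ler1n.
pose y := k%:R `^ eps.
have y0 : 0 < y by rewrite powR_gt0.
have y1 : 1 <= y by rewrite -[leLHS](powRr0 k%:R) ler_powR// ltW.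
have yr : k%:R ^+ 2 <= y ^+ r.
  by rewrite -!powR_mulrn ?powR_ge0 ?ler0n// -powRrM ler_powR.
have ky : k%:R `^ alpha / k%:R = (y ^+ 2)^-1.
  have ka0 : 0 < k%:R `^ alpha by rewrite powR_gt0.
  have -> : y ^+ 2 = k%:R / k%:R `^ alpha; last by rewrite invf_div.
  rewrite -powR_mulrn ?powR_ge0// -powRrM; apply: (mulIf (lt0r_neq0 ka0)).
  rewrite divfK// -powRD; last by rewrite lt0r_neq0 ?implybT.
  by rewrite subrK powRr1 ?ler0n// divfK// lt0r_neq0.
pose q := weibull_tail alpha k.+1.
have q0 : 0 < q by rewrite expR_gt0.
have q1 : q <= 1 by rewrite weibull_tail_le1.
pose N := (Num.trunc (y / q)).+1.
have yq0 : 0 <= y / q by rewrite divr_ge0 ?ltW.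
have N_ge : y / q <= N%:R by rewrite ltW// truncnS_gt.
have N_le : N.+1%:R <= 3 * (y / q).
  (* N + 1 <= y / q + 2, and y / q >= 1. *)
  have : (Num.trunc (y / q))%:R <= y / q by have /andP[] := truncn_itv yq0.
  have : 1 <= y / q by rewrite ler_pdivlMr// mul1r (le_trans q1).
  by rewrite /N -!natr1; lra.
exists N => js js_r js_k.
have stay : (1 - q) ^+ N <= r`!%:R / k%:R ^+ 2.
  apply: (@le_trans _ _ (expR (- y))).
    apply: (@le_trans _ _ (expR (- q) ^+ N)).
      by rewrite lerXn2r ?nnegrE ?subr_ge0 ?expR_ge0// expR_ge1Dx.
    rewrite -expRM_natr ler_expR mulNr lerN2.
    by rewrite -ler_pdivrMl// mulrC.
  (* The exponential dominates the r-th term of its power series. *)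
  rewrite expRN; apply: (@le_trans _ _ (y ^+ r / r`!%:R)^-1).
    rewrite lef_pV2 ?posrE ?expR_gt0 ?divr_gt0 ?exprn_gt0 ?ltr0n ?fact_gt0//.
    have := expR_ge1Dxn (Num.trunc (2 / eps)) (ltW y0); rewrite -/r; lra.
  rewrite invf_div ler_wpM2l ?ler0n// lef_pV2 ?posrE ?exprn_gt0//.
have hit : \prod_(j <- js)
    (N.+1%:R * (weibull_tail alpha j - weibull_tail alpha j.+1)) <= D ^+ r / k%:R ^+ 2.
  apply: (@le_trans _ _ (\prod_(j <- js) (D / y))).
    rewrite big_seq [leRHS]big_seq; apply: ler_prod => j /js_k /andP[jk_ge jk].
    have [j0 kjr k2j] := near_top_ge_half k0 rk jk_ge.
    have jdecr : weibull_tail alpha j.+1 <= weibull_tail alpha j.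
      by rewrite ler_expR lerD2l lerN2 ge0_ler_powR ?nnegrE ?ler0n ?ler_nat// ltW.
    apply/andP; split; first by rewrite mulr_ge0 ?subr_ge0.
    have kj : j%:R `^ alpha / j%:R <= 2 * (y ^+ 2)^-1.
      rewrite -ky mulrCA; apply: ler_pM; rewrite ?powR_ge0 ?invr_ge0 ?ler0n//.
        by rewrite ge0_ler_powR ?nnegrE ?ler0n ?ler_nat// ltW.
      rewrite ler_pdivlMr// mulrC ler_pdivrMr ?ltr0n// -natrM ler_nat.
      exact: k2j.
    apply: (@le_trans _ _ (3 * (y / q) * (expR r.+1%:R * q * (2 * (y ^+ 2)^-1)))).
      apply: ler_pM => //; first by rewrite subr_ge0.
      apply: le_trans (weibull_mass_le a01 j0 kjr) _.
      by rewrite ler_wpM2l// mulr_ge0 ?expR_ge0.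
    rewrite le_eqVlt; apply/orP; left; apply/eqP; rewrite /D.
    by field; rewrite !gt_eqF.
  rewrite big_const_seq count_predT js_r iter_mulr_1 expr_div_n.
  by rewrite ler_wpM2l ?exprn_ge0// lef_pV2 ?posrE ?exprn_gt0.
by rewrite mulrDl lerD.
Qed.

(** Telescoping: 1 / (j + 1)^2 <= 1 / j - 1 / (j + 1). *)
Lemma sum_inv_sqr_le (m n : nat) : (0 < m)%N ->
  \sum_(0 <= i < n) (m.+1 + i)%:R ^- 2 <= m%:R^-1 :> R.
Proof.
move=> m0.
suff tele : \sum_(0 <= i < n) (m.+1 + i)%:R ^- 2 <= m%:R^-1 - (m + n)%:R^-1 :> R.
  by rewrite (le_trans tele)// gerBl invr_ge0.
elim: n => [|n IHn]; first by rewrite big_nil addn0 subrr.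
rewrite big_nat_recr//= (le_trans (lerD IHn (lexx _)))//.
rewrite -addrA lerD2l addSn -addnS -lerBrDl opprK addrC.
have x0 : 0 < (m + n)%:R :> R by rewrite ltr0n addn_gt0 m0.
rewrite addnS -natr1; set x := (m + n)%:R in x0 *.
have -> : x^-1 - (x + 1)^-1 = (x * (x + 1))^-1 by field; rewrite !gt_eqF//; lra.
by rewrite lef_pV2 ?posrE; nra.
Qed.

End analysis.

(** * Positive probability that no interval is ever filled *)

Section stretched_exponential.
Context d (Omega : measurableType d) (R : realType) (P : probability Omega R).
Variables (X : nat -> {RV P >-> nat}) (alpha : R).
Hypotheses (X_iid : iid X) (alpha01 : 0 < alpha < 1).
Hypothesis X_tail : forall k : nat, (1 <= k)%N ->
  P (X 0%N @^-1` [set v | (k <= v)%N]) = (weibull_tail alpha k)%:E.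

Lemma law_le k : law X [set v | (v <= k)%N] = 1 - weibull_tail alpha k.+1.
Proof.
apply: EFin_inj; rewrite -(lawE X_iid 0) EFinB -(X_tail (ltn0Sn k)).
have -> : X 0%N @^-1` [set v | (v <= k)%N] = ~` (X 0%N @^-1` [set v | (k < v)%N]).
  by apply/seteqP; split=> w /=; [move/leq_gtF=> ->|move/negP; rewrite -leqNgt].
by rewrite probability_setC//; exact: measurable_funPTI.
Qed.

Lemma law_set1 j : (0 < j)%N ->
  law X [set j] = weibull_tail alpha j - weibull_tail alpha j.+1.
Proof.
move=> j0; apply: EFin_inj; rewrite -(lawE X_iid 0) EFinB -(X_tail j0) -(X_tail (ltn0Sn j)).
have -> : X 0%N @^-1` [set j] =
    X 0%N @^-1` [set v | (j <= v)%N] `\` X 0%N @^-1` [set v | (j < v)%N].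
  apply/seteqP; split=> w /=; first by move=> ->; rewrite ltnn leqnn.
  by case=> jX /negP; rewrite -leqNgt => Xj; apply/eqP; rewrite eqn_leq jX Xj.
have PjX : (P (X 0%N @^-1` [set v | (j <= v)%N]) < +oo)%E by rewrite X_tail// ltry.
rewrite (measureD _ _ PjX); try exact: measurable_funPTI.
by congr (_ - P _)%E; apply/setIidPr => w /=; exact: ltnW.
Qed.

Lemma law_set1_gt0 j : (0 < j)%N -> 0 < law X [set j].
Proof.
move=> j0; rewrite law_set1// subr_gt0 ltr_expR ltrD2l ltrN2.
have /andP[a0 _] := alpha01.
by rewrite gt0_ltr_powR ?nnegrE ?ler0n// ltr_nat.
Qed.

(** There are r + 1 candidates in the window, so r remain once [m] is left out. *)
Lemma exists_window (r m k : nat) : (2 * r < k)%N ->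
  exists js : seq nat, [/\ uniq js, m \notin js, size js = r &
    {in js, forall j, (k - r <= j <= k)%N}].
Proof.
move=> rk; pose s := rem m (iota (k - r) r.+1).
have us : uniq s by exact/rem_uniq/iota_uniq.
exists (take r s); split.
- exact: take_uniq.
- apply/negP => /mem_take; by rewrite mem_rem_uniq ?iota_uniq// inE eqxx.
- rewrite size_takel// /s; have [ms|ms] := boolP (m \in iota (k - r) r.+1).
    by rewrite size_rem// size_iota.
  by rewrite rem_id// size_iota.
- move=> j /mem_take /mem_rem; rewrite mem_iota => /andP[-> /=].
  by rewrite addnS ltnS subnK// (leq_trans _ (ltnW rk))// mul2n -addnn leq_addr.
Qed.

Lemma prob_never_fills_gt0 :
  (0 < P [set w | forall k, (1 <= k)%N -> forall n,
                    ~ fills_at (fun i => X i w) k n])%E.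
Proof.
have [r [c c0 bound]] := first_block_tail_bound alpha01.
(* Large enough for the bound to hold beyond m, with the sum of c / k^2 over
   k > m at most c / m < 1. The first sample is taken to be m + 1. *)
pose m := maxn (2 * r).+1 (Num.trunc c).+1.
have m0 : (0 < m)%N by rewrite leq_max ltn0Sn.
have cm : c / m%:R < 1.
  rewrite ltr_pdivrMr ?ltr0n// mul1r (lt_le_trans (truncnS_gt c))// ler_nat.
  exact: leq_maxr.
apply: (@never_fills_gt0 _ _ _ _ _ X_iid m.+1 (c / m%:R)).
- by rewrite cm andbT divr_ge0.
- exact: law_set1_gt0.
move=> n; apply: (@le_trans _ _
    (\sum_(0 <= i < n) (law X [set m.+1] * (c * (m.+1 + i)%:R ^- 2))%:E)%E).
  apply: lee_sum => i _; set k := (m.+1 + i)%N.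
  have rk : (2 * r < k)%N.
    by rewrite (leq_trans (leq_maxl _ (Num.trunc c).+1))// -/m /k addSn leqW// leq_addr.
  have k0 : (0 < k)%N by exact: leq_ltn_trans rk.
  have [N bN] := bound k k0 (ltnW rk).
  have [js [ujs mjs js_r js_k]] := exists_window m.+1 rk.
  have js_pos : {in js, forall j, (1 <= j <= k)%N}.
    move=> j /js_k /andP[kj ->]; rewrite andbT.
    by have [] := near_top_ge_half k0 (ltnW rk) kj.
  apply: le_trans (prob_start_fills_le X_iid N ujs mjs js_pos) _.
  rewrite lee_fin ler_wpM2l ?law_ge0// (le_trans _ (bN js js_r js_k))//.
  rewrite law_le lerD2l le_eqVlt; apply/orP; left; apply/eqP.
  by apply: eq_big_seq => j /js_pos /andP[j0 _]; rewrite law_set1.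
rewrite sumEFin lee_fin -mulr_sumr ler_wpM2l ?law_ge0// -mulr_sumr ler_wpM2l//.
exact: sum_inv_sqr_le.
Qed.

End stretched_exponential.

Theorem theorem4 (R : realType) (alpha C : R)
    (d : measure_display) (Omega : measurableType d) (P : probability Omega R)
    (X : nat -> {RV P >-> nat})
    (alpha_gt0 : 0 < alpha) (alpha_lt1 : alpha < 1)
    (X_iid : iid X)
    (X_tail : forall k : nat, (1 <= k)%N ->
      P [set w | (k <= X 0%N w)%N] = (C * expR (- (k%:R `^ alpha)))%:E)
    (C_normalizes : P [set w | (1 <= X 0%N w)%N] = 1%E) :
  (0 < P [set w | first_block_size R (fun n => X n w) = +oo])%E.
Proof.
have C_e : C = expR 1.
  have := X_tail 1%N isT; rewrite C_normalizes powR1 => -[C1].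
  by apply: divr1_eq; rewrite -expRN -C1.
have tailE k : (1 <= k)%N ->
    P (X 0%N @^-1` [set v | (k <= v)%N]) = (weibull_tail alpha k)%:E.
  by move=> k1; rewrite /weibull_tail expRD -C_e; exact: X_tail.
have alpha01 : 0 < alpha < 1 by rewrite alpha_gt0.
rewrite (_ : [set w | _] = [set w | forall k, (1 <= k)%N -> forall n,
    ~ fills_at (fun i => X i w) k n]); first exact: prob_never_fills_gt0 tailE.
by apply/seteqP; split=> w /=; rewrite first_block_size_pinfty.
Qed.
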